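(* Let $\mathcal M=(M,<,\ldots)$ be a uniformly locally weakly o-minimal structure of the second kind. Let $X$ be a definable subset of $M^n$ with nonempty interior and let $X=X_1\cup X_2$ be a partition of $X$ into two definable subsets. Then at least one of $X_1$ and $X_2$ has nonempty interior.
   Context: $\mathcal M$ is an expansion of a dense linear order without endpoints; ''definable'' means with parameters; $M^n$ carries the product of order topologies. For $X\subseteq M^{n+1}$ and $x\in M^n$, $X_x=\{y\in M:(x,y)\in X\}$. $\mathcal M$ is uniformly locally weakly o-minimal of the second kind if (a) for every definable $X\subseteq M$ and $a\in M$ there is an open interval $I\ni a$ with $X\cap I$ a union of a finite set and finitely many open convex sets, and (b) for every $n\ge1$, definable $X\subseteq M^{n+1}$, $a\in M$ and $b\in M^n$ there exist an open interval $I\ni a$ and an open box $B\ni b$ such that $X_x\cap I$ is a union of a finite set and finitely many open convex sets for all $x\in B$. *)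

(* Defs.v *)
From mathcomp Require Import all_boot all_order all_algebra all_classical.
From mathcomp Require Import topology function_spaces.

Set Implicit Arguments.
Unset Strict Implicit.
Unset Printing Implicit Defensive.

Import Order.TTheory.
Local Open Scope classical_set_scope.

(* Constants are the function symbols of arity 0. The symbol < is not in the
   language: it is a primitive of [formula], always read as the order of M, so
   that a structure below is an expansion of the order on M. *)
Record language := Language {
  fun_sym : Type;
  fun_arity : fun_sym -> nat;
  rel_sym : Type;
  rel_arity : rel_sym -> nat }.

Record expansion (L : language) (M : Type) := Expansion {
  fun_interp : forall f : fun_sym L, ('I_(fun_arity f) -> M) -> M;
  rel_interp : forall r : rel_sym L, ('I_(rel_arity r) -> M) -> Prop }.

(* Terms in n free variables, with elements of M as parameters. *)
Inductive term (L : language) (M : Type) (n : nat) : Type :=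
| Var of 'I_n
| Par of M
| App (f : fun_sym L) of ('I_(fun_arity f) -> term L M n).

(* [FEx] binds the last variable. *)
Inductive formula (L : language) (M : Type) : nat -> Type :=
| FEq n of term L M n & term L M n : formula L M n
| FLt n of term L M n & term L M n : formula L M n
| FRel n (r : rel_sym L) of ('I_(rel_arity r) -> term L M n) : formula L M n
| FNot n of formula L M n : formula L M n
| FAnd n of formula L M n & formula L M n : formula L M n
| FEx n of formula L M n.+1 : formula L M n.

(* (x_0, ..., x_(n-1)), y |-> (x_0, ..., x_(n-1), y) *)
Definition snoc (M : Type) (n : nat) (x : 'I_n -> M) (y : M) : 'I_n.+1 -> M :=
  fun i => oapp x y (unlift ord_max i).

Section Structures.
Context {d : Order.disp_t} {M : orderTopologicalType d} {L : language}.
Variable S : expansion L M.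

Fixpoint eval n (x : 'I_n -> M) (t : term L M n) : M :=
  match t with
  | Var i => x i
  | Par c => c
  | App f ts => fun_interp S (fun i => eval x (ts i))
  end.

Fixpoint sat n (phi : formula L M n) : ('I_n -> M) -> Prop :=
  match phi in formula _ _ k return ('I_k -> M) -> Prop with
  | FEq _ t u => fun x => eval x t = eval x u
  | FLt _ t u => fun x => (eval x t < eval x u)%O
  | FRel _ r ts => fun x => rel_interp S (fun i => eval x (ts i))
  | FNot _ psi => fun x => ~ sat psi x
  | FAnd _ psi chi => fun x => sat psi x /\ sat chi x
  | FEx _ psi => fun x => exists y : M, sat psi (snoc x y)
  end.

(* M^n with its product topology is {ptws 'I_n -> M}. *)
Definition definable n (X : set {ptws 'I_n -> M}) : Prop :=
  exists phi : formula L M n, X = [set x | sat phi x].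

(* Subsets of M are identified with subsets of M^1. *)
Definition definable1 (X : set M) : Prop :=
  @definable 1 [set x | X (x ord0)].

End Structures.

Section Tameness.
Context {d : Order.disp_t} {M : orderTopologicalType d}.

Definition order_convex (C : set M) : Prop :=
  forall x y, C x -> C y -> forall z, (x <= z <= y)%O -> C z.

(* Endpoints may be infinite. *)
Definition open_interval (I : set M) : Prop :=
  exists2 i : interval M, itv_open_ends i & I = [set` i].

Definition open_box n (B : set {ptws 'I_n -> M}) : Prop :=
  exists2 I : 'I_n -> set M,
    (forall i, open_interval (I i)) & B = [set x | forall i, I i (x i)].

Definition finite_union_of_points_and_open_convex (A : set M) : Prop :=
  exists (F : set M) (k : nat) (C : 'I_k -> set M),
    [/\ finite_set F,
        (forall i, open (C i) /\ order_convex (C i)) &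
        A = F `|` \bigcup_i C i].

Definition fiber n (X : set {ptws 'I_n.+1 -> M}) (x : {ptws 'I_n -> M}) :
  set M := [set y | X (snoc x y)].

End Tameness.

Definition dense_without_endpoints d (M : orderTopologicalType d) : Prop :=
  [/\ (forall x y : M, (x < y)%O -> exists z, (x < z < y)%O),
      (forall x : M, exists y, (y < x)%O) &
      (forall x : M, exists y, (x < y)%O)].

Definition unif_locally_weakly_ominimal2 d (M : orderTopologicalType d)
    (L : language) (S : expansion L M) : Prop :=
  (forall (X : set M) (a : M), definable1 S X ->
     exists I : set M, [/\ open_interval I, I a &
       finite_union_of_points_and_open_convex (X `&` I)])
  /\
  (forall (n : nat) (X : set {ptws 'I_n.+1 -> M}) (a : M)
      (b : {ptws 'I_n -> M}), (1 <= n)%N -> definable S X ->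
     exists (I : set M) (B : set {ptws 'I_n -> M}),
       [/\ open_interval I, I a, open_box B, B b &
           forall x, B x ->
             finite_union_of_points_and_open_convex (fiber X x `&` I)]).

(* Main.v *)
(* Everything is reduced to two facts about the line: a definable subset of M
   contains or misses a right germ at each point, and if an interval is the
   union of an increasing definable family Z_y as y decreases to a, some Z_y
   contains an interval. Otherwise all Z_y are finite near a point, so the
   points, ordered by the first y at which they appear (ties broken by <), have
   a maximum in every nonempty set; the left children and the right children of
   the resulting Cartesian tree are disjoint and dense, contradicting local
   tameness.
   The second fact passes to boxes by induction on the dimension, applied in
   turn to several "germ" families, without any bound on the number of convex
   components of fibers. For the theorem in dimension n+1, fix a last
   coordinate a: each fiber of X_1 or of X_2 contains a right germ at a. By
   induction this happens for the same X_i over a box, and the union property,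
   with the length of the germ as parameter, gives a box in X_i. *)
Require Import Defs.
From mathcomp Require Import all_boot all_order all_algebra all_classical.
From mathcomp Require Import topology function_spaces.

Set Implicit Arguments.
Unset Strict Implicit.
Unset Printing Implicit Defensive.
Import Order.TTheory.
Local Open Scope classical_set_scope.

(** * Closure of definable predicates under substitution and logical operations *)

Section Definability.
Context {d : Order.disp_t} {M : orderTopologicalType d} {L : language}.
Variable S : expansion L M.

Definition def n (P : ('I_n -> M) -> Prop) :=
  exists phi : formula L M n, forall x, P x <-> sat S phi x.

(** Substituting variables and parameters is enough below: it covers permuting, repeating and fixing
    coordinates. *)
Definition coordinate n (u : ('I_n -> M) -> M) :=
  (exists i, u = fun x => x i) \/ (exists c, u = fun=> c).

Lemma coordinate_var n (i : 'I_n) : coordinate (fun x : 'I_n -> M => x i).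
Proof. by left; exists i. Qed.

Lemma coordinate_par n (c : M) : coordinate (fun x : 'I_n -> M => c).
Proof. by right; exists c. Qed.

Lemma coordinate_snoc n m (X : ('I_m -> M) -> 'I_n -> M) Y :
  (forall i, coordinate (fun x => X x i)) -> coordinate Y ->
  forall i, coordinate (fun x => snoc (X x) (Y x) i).
Proof. by move=> hX hY i; rewrite /snoc; case: (unlift ord_max i) => [j|] /=. Qed.

Lemma snoc_lift n (x : 'I_n -> M) y i : snoc x y (lift ord_max i) = x i.
Proof. by rewrite /snoc liftK. Qed.

Lemma snoc_max n (x : 'I_n -> M) y : snoc x y ord_max = y.
Proof. by rewrite /snoc unlift_none. Qed.

Lemma snoc_eta n (x : 'I_n.+1 -> M) :
  snoc (fun i => x (lift ord_max i)) (x ord_max) = x.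
Proof.
by apply/funext => i; rewrite /snoc; case: unliftP => [j|] ->.
Qed.

Lemma term_subst n m (t : term L M n) (u : 'I_n -> term L M m) :
  exists t' : term L M m, forall x,
    Defs.eval S x t' = Defs.eval S (fun i => Defs.eval S x (u i)) t.
Proof.
elim: t => [i|c|f ts IH]; [by exists (u i)|by exists (Par _ _ c)|].
have [ts' tsE] := choice IH.
by exists (App ts') => x /=; congr fun_interp; apply/funext => i; apply: tsE.
Qed.

Lemma formula_subst n (phi : formula L M n) m (u : 'I_n -> term L M m) :
  exists psi : formula L M m, forall x,
    sat S psi x <-> sat S phi (fun i => Defs.eval S x (u i)).
Proof.
elim: phi m u => {n}[n s t|n s t|n r ts|n p IH|n p IHp q IHq|n p IH] m u.
- have [s' sE] := term_subst s u; have [t' tE] := term_subst t u.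
  by exists (FEq s' t') => x /=; rewrite sE tE.
- have [s' sE] := term_subst s u; have [t' tE] := term_subst t u.
  by exists (FLt s' t') => x /=; rewrite sE tE.
- have [ts' tsE] := choice (fun i => term_subst (ts i) u).
  exists (FRel ts') => x /=.
  by under eq_fun do rewrite tsE.
- by have [p' pE] := IH m u; exists (FNot p') => x /=; rewrite pE.
- have [p' pE] := IHp m u; have [q' qE] := IHq m u.
  by exists (FAnd p' q') => x /=; rewrite pE qE.
- have [u' uE] := choice (fun i =>
    term_subst (u i) (fun j => Var L M (lift ord_max j))).
  (* Under the quantifier the bound last variable is kept, and the substituted terms are weakened so
     as to ignore it. *)
  pose v i := oapp u' (Var L M ord_max) (unlift ord_max i).
  have [p' pE] := IH m.+1 v; exists (FEx p') => x /=.
  suff vE y : (fun i => Defs.eval S (snoc x y) (v i)) =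
              snoc (fun i => Defs.eval S x (u i)) y.
    by split=> -[y h]; exists y; move: h; rewrite pE vE.
  apply/funext => i; rewrite /v /snoc; case: (unliftP ord_max i) => [j|] _ /=.
    rewrite uE; congr (Defs.eval S _ _); apply/funext => k /=.
    by rewrite liftK.
  by rewrite unlift_none.
Qed.

Lemma def_ext n (P Q : ('I_n -> M) -> Prop) :
  (forall x, P x <-> Q x) -> def P -> def Q.
Proof. by move=> PQ [phi h]; exists phi => x; rewrite -PQ h. Qed.

Lemma def_not n (P : ('I_n -> M) -> Prop) : def P -> def (fun x => ~ P x).
Proof. by move=> [p h]; exists (FNot p) => x /=; rewrite h. Qed.

Lemma def_and n (P Q : ('I_n -> M) -> Prop) :
  def P -> def Q -> def (fun x => P x /\ Q x).
Proof. by move=> [p h] [q k]; exists (FAnd p q) => x /=; rewrite h k. Qed.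

Lemma def_or n (P Q : ('I_n -> M) -> Prop) :
  def P -> def Q -> def (fun x => P x \/ Q x).
Proof.
move=> hP hQ; apply: def_ext (def_not (def_and (def_not hP) (def_not hQ))) => x.
by rewrite not_andP !notK.
Qed.

Lemma def_imp n (P Q : ('I_n -> M) -> Prop) :
  def P -> def Q -> def (fun x => P x -> Q x).
Proof.
move=> hP hQ; apply: def_ext (def_or (def_not hP) hQ) => x.
by rewrite implyE.
Qed.

Lemma def_ex n (P : ('I_n -> M) -> M -> Prop) :
  def (fun x : 'I_n.+1 -> M => P (fun i => x (lift ord_max i)) (x ord_max)) ->
  def (fun x => exists y, P x y).
Proof.
move=> [p h]; exists (FEx p) => x /=.
have E y : P x y <-> sat S p (snoc x y).
  rewrite -h snoc_max; suff -> : (fun i => snoc x y (lift ord_max i)) = x by [].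
  by apply/funext => i; rewrite snoc_lift.
by split=> -[y k]; exists y; apply/E.
Qed.

Lemma def_all n (P : ('I_n -> M) -> M -> Prop) :
  def (fun x : 'I_n.+1 -> M => P (fun i => x (lift ord_max i)) (x ord_max)) ->
  def (fun x => forall y, P x y).
Proof.
move=> /def_not/(@def_ex n (fun x y => ~ P x y))/def_not.
apply: def_ext => x; split=> [h y|h [y]]; last exact.
by apply: contrapT => nP; apply: h; exists y.
Qed.

Lemma coordinate_term n (u : ('I_n -> M) -> M) :
  coordinate u -> exists t : term L M n, u = fun x => Defs.eval S x t.
Proof.
by move=> [[i ->]|[c ->]]; [exists (Var _ _ i)|exists (Par _ _ c)].
Qed.

Lemma def_lt n (u v : ('I_n -> M) -> M) :
  coordinate u -> coordinate v -> def (fun x => u x < v x)%O.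
Proof.
by move=> /coordinate_term[s ->] /coordinate_term[t ->]; exists (FLt s t).
Qed.

Lemma def_eq n (u v : ('I_n -> M) -> M) :
  coordinate u -> coordinate v -> def (fun x => u x = v x).
Proof.
by move=> /coordinate_term[s ->] /coordinate_term[t ->]; exists (FEq s t).
Qed.

Lemma def_comp n m (P : ('I_n -> M) -> Prop) (X : ('I_m -> M) -> 'I_n -> M) :
  def P -> (forall i, coordinate (fun x => X x i)) -> def (fun x => P (X x)).
Proof.
move=> [p h] hX.
have [t tE] := choice (fun i => coordinate_term (hX i)).
have [q qE] := formula_subst p t; exists q => x; rewrite h qE.
by suff -> : X x = (fun i => Defs.eval S x (t i)) by []; apply/funext => i;
  rewrite -[RHS]/((fun x => Defs.eval S x (t i)) x) -tE.
Qed.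

Definition def2 n (Z : ('I_n -> M) -> M -> Prop) :=
  def (fun x : 'I_n.+1 -> M => Z (fun i => x (lift ord_max i)) (x ord_max)).

Lemma def2_comp n m (Z : ('I_n -> M) -> M -> Prop)
    (X : ('I_m -> M) -> 'I_n -> M) (Y : ('I_m -> M) -> M) :
  def2 Z -> (forall i, coordinate (fun x => X x i)) -> coordinate Y ->
  def (fun x => Z (X x) (Y x)).
Proof.
move=> hZ hX hY; have := def_comp hZ (coordinate_snoc hX hY).
apply: def_ext => x; rewrite snoc_max.
suff -> : (fun i => snoc (X x) (Y x) (lift ord_max i)) = X x by [].
by apply/funext => i; rewrite snoc_lift.
Qed.

End Definability.

(** * Right germs and Cartesian trees in a dense linear order *)

Section Order.
Context {d : Order.disp_t} {M : orderTopologicalType d}.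
Local Open Scope order_scope.
Implicit Types (a b e p q s t x y : M) (P A B : M -> Prop).

Definition right_germ q A := exists2 s, q < s & forall t, q < t < s -> A t.

Definition decides_germ q A := right_germ q A \/ right_germ q (fun t => ~ A t).

Lemma right_germS q A B : (forall t, A t -> B t) ->
  right_germ q A -> right_germ q B.
Proof. by move=> AB [s qs sA]; exists s => // t /sA/AB. Qed.

Lemma right_germI q A B : right_germ q A -> right_germ q B ->
  right_germ q (fun t => A t /\ B t).
Proof.
move=> [s qs sA] [r qr rB]; exists (Order.min s r); first by rewrite lt_min qs.
by move=> t; rewrite lt_min => /and3P[qt ts tr]; split; [apply: sA|apply: rB];
  rewrite qt.
Qed.

Hypothesis dlo : dense_without_endpoints M.

Lemma right_germ_all (I : eqType) (r : seq I) q (A : I -> M -> Prop) :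
  (forall i, i \in r -> right_germ q (A i)) ->
  right_germ q (fun t => forall i, i \in r -> A i t).
Proof.
elim: r => [|i r IH] h; first by have [_ _ /(_ q)[s qs]] := dlo; exists s.
have hi : right_germ q (A i) by apply: h; rewrite mem_head.
have hr : right_germ q (fun t => forall j, j \in r -> A j t).
  by apply: IH => j jr; apply: h; rewrite inE jr orbT.
apply: right_germS (right_germI hi hr) => t [Ai Ar] j.
by rewrite inE => /predU1P[->|/Ar].
Qed.

Lemma nbhs_itv (U : set M) a : nbhs a U ->
  exists p q, [/\ p < a, a < q & forall z, p < z < q -> U z].
Proof.
have [_ ltl ltr] := dlo.
rewrite itv_nbhsE => -[i [oi ai] iU].
(* [p0] and [q0] stand in for infinite endpoints. *)
have [p0 p0a] := ltl a; have [q0 aq0] := ltr a.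
move: oi ai iU; case: i => -[[] l|[]] [[] r|[]] //= _; rewrite ?in_itv /=.
all: rewrite ?andbT => ai iU.
- by case/andP: ai => la ar; exists l, r.
- exists l, q0; split=> // z /andP[lz _].
  by apply: iU; rewrite /= in_itv /= lz.
- exists p0, r; split=> // z /andP[_ zr].
  by apply: iU; rewrite /= in_itv /= zr.
- by exists p0, q0; split=> // z _; apply: iU; rewrite /= in_itv.
Qed.

Lemma open_interval_nbhs (I : set M) a : open_interval I -> I a -> nbhs a I.
Proof.
by move=> [i oi ->] ai; apply: open_nbhs_nbhs; split=> //;
  apply: itv_open_ends_open.
Qed.

Lemma nbhs_right_germ (U : set M) q : nbhs q U -> right_germ q U.
Proof.
move=> /nbhs_itv[p [s [pq qs sU]]]; exists s => // t /andP[qt ts].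
by apply: sU; rewrite (lt_trans pq qt).
Qed.

(** If no right germ at [q] avoids [C], then [C] has points arbitrarily close to [q] on the right,
    and convexity fills in everything from [q] up to any one of them. *)
Lemma convex_decides_germ (C : set M) q : order_convex C -> decides_germ q C.
Proof.
move=> cC; have [|nC] := pselect (right_germ q (fun t => ~ C t)); first by right.
have meets s : q < s -> exists2 w, q < w < s & C w.
  move=> qs; apply: contrapT => h; apply: nC; exists s => // t qts Ct.
  by apply: h; exists t.
have [_ _ /(_ q)[s /meets[c /andP[qc _] Cc]]] := dlo.
left; exists c => // t /andP[/meets[w /andP[_ wt] Cw] tc].
by apply: cC Cw Cc _ _; rewrite !ltW.
Qed.

(** Either some convex piece contains a right germ, or each of the finitely many pieces and points
    is avoided by one, and these germs can be intersected. *)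
Lemma decides_germ_finite_union (U : set M) q :
  finite_union_of_points_and_open_convex U -> decides_germ q U.
Proof.
move=> [F [k [C [/finite_seqP[r ->] hC ->]]]].
have dC i : decides_germ q (C i) by apply: convex_decides_germ; case: (hC i).
have [[i Ci]|noC] := pselect (exists i, right_germ q (C i)).
  by left; apply: right_germS Ci => t Ct; right; exists i.
right; have hr : right_germ q (fun t => forall x, x \in r -> t <> x).
  apply: right_germ_all => x _; have [xq|qx] := leP x q.
    have [_ _ /(_ q)[s qs]] := dlo; exists s => // t /andP[qt _] tx.
    by move: qt; rewrite tx ltNge xq.
  by exists x => // t /andP[_ tx] E; move: tx; rewrite E ltxx.
have hC' : right_germ q (fun t => forall i, i \in enum 'I_k -> ~ C i t).
  apply: right_germ_all => i _; case: (dC i) => // Ci.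
  by case: noC; exists i.
apply: right_germS (right_germI hr hC') => t [h1 h2] [/= /h1//|[i _ Ci]].
by apply: h2 Ci; rewrite mem_enum.
Qed.

(* In the Cartesian tree of lt on ]b, e[, the parent of x is the lt-smaller of
   its two nearest neighbours l < x < r above it. Here the parent is r, so x is
   a left child. *)
Definition left_child b e (lt : M -> M -> Prop) x :=
  exists l r, b < l /\ l < x /\ x < r /\ r < e /\
    (forall t, l < t -> t < r -> t <> x -> lt t x) /\ lt x r /\ lt r l.

(** Every interval inside []b, e[] has an [lt]-maximum. Taking successive maxima produces a left
    child and a right child arbitrarily close to [b]. *)
Lemma left_child_undecided b e (lt : M -> M -> Prop) : b < e ->
  (forall x, ~ lt x x) -> (forall x y z, lt x y -> lt y z -> lt x z) ->
  (forall A, (exists2 x, b < x < e & A x) -> exists m, [/\ b < m < e, A m &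
     forall x, b < x < e -> A x -> x <> m -> lt x m]) ->
  ~ decides_germ b (left_child b e lt).
Proof.
move=> be ltI ltT maxP; have [dense _ _] := dlo.
have neq x y : x < y -> x <> y by move=> xy E; rewrite E ltxx in xy.
have itv_max u v : b <= u -> u < v -> v <= e ->
    exists m, [/\ u < m, m < v & forall x, u < x -> x < v -> x <> m -> lt x m].
  move=> bu uv ve; have [|m [_ /andP[um mv] h]] := maxP (fun x => u < x < v).
    have [x /andP[ux xv]] := dense _ _ uv; exists x; last by rewrite ux.
    by rewrite (le_lt_trans bu ux) (lt_le_trans xv ve).
  exists m; split=> // x ux xv; apply: h; last by rewrite ux.
  by rewrite (le_lt_trans bu ux) (lt_le_trans xv ve).
suff dens s : b < s -> s <= e ->
    (exists2 x, b < x < s & left_child b e lt x) /\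
    (exists2 x, b < x < s & ~ left_child b e lt x).
  case=> -[s bs sP]; have [||[x hx Px] [y hy Py]] := dens (Order.min s e);
    rewrite ?lt_min ?bs ?ge_min ?lexx ?orbT //.
    by apply: Py; apply: sP; move: hy; rewrite lt_min => /and3P[-> ->].
  by apply: sP Px; move: hx; rewrite lt_min => /and3P[-> ->].
move=> bs se; have [w [bw ws wmax]] := itv_max _ _ (lexx b) bs se.
split.
  (* To the right of the root [w] of []b, s[]: the nearest points above [w2] are [w] and [w1], and
     the smaller of these, its parent [w1], lies on its right. *)
  have [w1 [ww1 w1s w1max]] := itv_max _ _ (ltW bw) ws se.
  have [w2 [ww2 w21 w2max]] :=
    itv_max _ _ (ltW bw) ww1 (ltW (lt_le_trans w1s se)).
  exists w2; first by rewrite (lt_trans bw ww2) (lt_trans w21 w1s).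
  exists w, w1; do !split=> //; first exact: lt_le_trans w1s se.
    by apply: w1max => //; [exact: lt_trans w1s|exact: neq].
  by apply: wmax => //; [exact: lt_trans ww1|exact/nesym/neq].
have we := ltW (lt_le_trans ws se).
(* To the left of [w]: the nearest points above [w2] are [w1] and [w], and the smaller of these, its
   parent [w1], now lies on its left. *)
have [w1 [bw1 w1w w1max]] := itv_max _ _ (lexx b) bw we.
have [w2 [w12 w2w w2max]] := itv_max _ _ (ltW bw1) w1w we.
have l21 : lt w2 w1.
  by apply: w1max => //; [exact: lt_trans w12|exact/nesym/neq].
have l1 : lt w1 w.
  by apply: wmax => //; [exact: lt_trans ws|exact: neq].
exists w2; first by rewrite (lt_trans bw1 w12) (lt_trans w2w ws).
move=> [l [r [bl [lw2 [w2r [re [lrmax [l2r lrl]]]]]]]].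
(* The two neighbours are unique: with any other [l] or [r], some point would be both above and
   below [w2] for [lt]. *)
have El : l = w1.
  have [lw1|w1l|//] := ltgtP l w1; exfalso.
    apply: (ltI w2); apply: ltT l21 _; apply: lrmax => //; last exact: neq.
    exact: lt_trans w2r.
  apply: (ltI w2); apply: ltT l2r (ltT _ _ _ lrl _); apply: w2max => //.
    exact: lt_trans w2w.
  exact: neq.
have Er : r = w.
  have [rw|wr|//] := ltgtP r w; exfalso.
    apply: (ltI w2); apply: ltT l2r _; apply: w2max => //.
      exact: lt_trans w2r.
    exact/nesym/neq.
  apply: (ltI w2); apply: ltT (ltT _ _ _ l21 l1) _; apply: lrmax => //.
    exact: lt_trans w2w.
  exact/nesym/neq.
by apply: (ltI w1); apply: ltT l1 _; rewrite -El -Er.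
Qed.

Lemma seq_max (lt : M -> M -> Prop) (r : seq M) x0 :
  (forall x y z, lt x y -> lt y z -> lt x z) ->
  (forall x y, x <> y -> lt x y \/ lt y x) -> x0 \in r ->
  exists2 m, m \in r & forall x, x \in r -> x <> m -> lt x m.
Proof.
move=> ltT ltot; elim: r x0 => // y r IH x0 _.
case: r IH => [_|z r /(_ z)[|m mr mmax]]; last 2 first.
- by rewrite mem_head.
- have [->|/eqP/ltot[ym|my]] := eqVneq y m.
  + exists m; first exact: mem_head.
    by move=> x; rewrite inE => /predU1P[|/mmax].
  + exists m; first by rewrite inE mr orbT.
    by move=> x; rewrite inE => /predU1P[->|/mmax].
  + exists y; first exact: mem_head.
    move=> x; rewrite inE => /predU1P[->//|xr _].
    have [->//|/eqP xm] := eqVneq x m.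
    exact: ltT (mmax _ xr xm) my.
exists y; first exact: mem_head.
by move=> x; rewrite mem_seq1 => /eqP->.
Qed.

End Order.

(** * Increasing definable families on the line *)

Section Families.
Context {d : Order.disp_t} {M : orderTopologicalType d} {L : language}.
Variable S : expansion L M.
Hypothesis dlo : dense_without_endpoints M.
Hypothesis tame : unif_locally_weakly_ominimal2 S.
Local Open Scope order_scope.

Ltac coord := solve [apply: coordinate_var | apply: coordinate_par
  | by move=> ?; apply: coordinate_var | by move=> ?; apply: coordinate_par].
(** Follows the syntax of a predicate and leaves only the occurrences of families already assumed
    definable. *)
Ltac defin := cbv beta;
  first [ apply: def_lt; coord
        | apply: def_eq; coord
        | apply: def_ex; defin | apply: def_all; defin
        | apply: def_and; defin | apply: def_or; defin
        | apply: def_not; defin | apply: def_imp; defin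
        | idtac ].

(** Tameness describes [A] only inside [I], so the negative case also needs a right germ contained
    in [I]. *)
Lemma definable_decides_germ (A : M -> Prop) q :
  def S (fun x : 'I_1 -> M => A (x ord0)) -> decides_germ q A.
Proof.
move=> [phi h]; have [|I [oI Iq fI]] := tame.1 A q.
  by exists phi; apply/seteqP; split=> x /= /h.
have hI := nbhs_right_germ dlo (open_interval_nbhs oI Iq).
case: (decides_germ_finite_union dlo q fI) => hA; [left|right].
  by apply: right_germS hA => t [].
by apply: right_germS (right_germI hI hA) => t [It nAI] At; apply: nAI.
Qed.

Definition antitone_above a (A : M -> Prop) :=
  forall y y', a < y' -> y' <= y -> A y -> A y'.

Lemma def_bin (Z : M -> M -> Prop) m (u w : ('I_m -> M) -> M) :
  def2 S (fun x : 'I_1 -> M => Z (x ord0)) -> coordinate u -> coordinate w ->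
  def S (fun x => Z (u x) (w x)).
Proof.
by move=> hZ hu hw; apply: (def2_comp (X := fun x _ => u x) hZ).
Qed.

Lemma union_interval (Z : M -> M -> Prop) a b e :
  def2 S (fun x : 'I_1 -> M => Z (x ord0)) -> b < e ->
  (forall x, antitone_above a (Z x)) ->
  (forall x, b < x < e -> exists2 y, a < y & Z x y) ->
  exists2 y, a < y & exists u v, [/\ b <= u, u < v, v <= e &
    forall x, u < x < v -> Z x y].
Proof.
move=> hZ be anti cover; apply: contrapT => noint; have [dense _ _] := dlo.
(* The parameter [y] comes first and the point [x] last, so that tameness at [(a, b)] is uniform in
   [y] near [a]. *)
pose X : set {ptws 'I_2 -> M} := [set v |
  b < v ord_max /\ v ord_max < e /\ Z (v ord_max) (v ord0)].
have [phi hphi] : def S X.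
  rewrite /X /=; defin.
  by apply: (def_bin hZ (u := fun x => x ord_max)); coord.
have [|I [B [oI Ib [K hK EB] Ba fIB]]] := tame.2 1%N X b (fun=> a) isT.
  by exists phi; apply/seteqP; split=> v /hphi.
have Ka : right_germ a (K ord0).
  apply: nbhs_right_germ => //; apply: open_interval_nbhs => //.
  by move: Ba; rewrite EB; apply.
have [e0 be0 e0I] : right_germ b I.
  by apply: nbhs_right_germ => //; apply: open_interval_nbhs.
have [a' aa' a'K] := Ka.
pose e' := Order.min e e0.
have be' : b < e' by rewrite lt_min be.
(* Replace [y] by a smaller [y'] in the range of uniformity, which only enlarges the set. An open
   convex piece meeting []b, e'[] would contain an interval, against [noint]; so only the finite
   part remains. *)
have finZ y : a < y -> exists r : seq M, forall x, b < x < e' -> Z x y -> x \in r.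
  move=> ay; have [|y' /andP[ay']] := dense a (Order.min y a').
    by rewrite lt_min ay.
  rewrite lt_min => /andP[y'y y'a'].
  have [|F [k [C [/finite_seqP[r ->] oC EC]]]] := fIB (fun=> y').
    rewrite EB /= => i; rewrite (ord1 i); apply: a'K; exact/andP.
  have fE x : fiber X (fun=> y') x <-> b < x /\ x < e /\ Z x y'.
    rewrite /fiber /X /= snoc_max.
    suff -> : snoc (fun=> y' : M) x (ord0 : 'I_2) = y' by [].
    by rewrite (_ : ord0 = lift ord_max ord0) ?snoc_lift //; apply: val_inj.
  have EC' x : ((b < x /\ x < e /\ Z x y') /\ I x) <->
      (x \in r \/ exists i, C i x).
    rewrite -fE; have : (fiber X (fun=> y') `&` I)%classic x <->
      ([set` r] `|` \bigcup_i C i)%classic x by rewrite -EC.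
    by move=> h; split=> [/h[|[i _ ?]]|[xr|[i Ci]]];
      [left|right; exists i|apply/h; left|apply/h; right; exists i].
  exists r => x; rewrite lt_min => /and3P[bx xe xe0] Zx.
  have [|//|[i Cx]] := (EC' x).1.
    split; last by apply: e0I; rewrite bx.
    by split=> //; split=> //; apply: anti Zx => //; apply: ltW.
  case: noint; have [oCi _] := oC i.
  have [p [q [px xq pqC]]] := nbhs_itv dlo (open_nbhs_nbhs (conj oCi Cx)).
  exists y' => //; exists x, (Order.min q e).
  rewrite (ltW bx) lt_min xq xe ge_min lexx orbT; split=> // z.
  rewrite lt_min => /and3P[xz zq _].
  have [|[_ [_]] //] := (EC' z).2.
  by right; exists i; apply: pqC; rewrite (lt_trans px xz).
(* [x'] appears no later than [x] as [y] decreases to [a]; antitonicity makes this preorder total.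
   On ties, [lt] ranks the [<]-smaller point higher. *)
pose le x x' := forall y, a < y -> Z x y -> Z x' y.
have le_total x x' : ~ le x' x -> le x x'.
  move=> nle y' ay' Zx; apply: contrapT => nZ; apply: nle => y ay Zx'.
  have [yy'|y'y] := leP y y'; first exact: anti Zx.
  by case: nZ; apply: anti Zx' => //; apply: ltW.
have le_trans x y z : le x y -> le y z -> le x z by move=> xy yz t at_ /(xy _ at_)/(yz _ at_).
pose lt x x' := ~ le x' x \/ (le x x' /\ x' < x).
have ltt x y : x <> y -> lt x y \/ lt y x.
  move=> /eqP xNy; have [yx|] := pselect (le y x); last by left; left.
  have [xy|] := pselect (le x y); last by right; left.
  by case/orP: (Order.TotalTheory.lt_total xNy) => ?; [right|left]; right.
have ltT x y z : lt x y -> lt y z -> lt x z.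
  move=> [yx|[xy yx]] [zy|[yz zy]].
  - by left => zx; apply: zy; apply: le_trans zx _; apply: le_total.
  - by left => zx; apply: yx; apply: le_trans yz zx.
  - by left => zx; apply: zy; apply: le_trans zx xy.
  - right; split; [exact: le_trans xy yz|exact: lt_trans zy yx].
apply: (@left_child_undecided _ _ dlo b e' lt).
- by [].
- by move=> x [|[_]]; rewrite ?ltxx //; apply.
- exact: ltT.
- move=> A [x0 bx0 Ax0].
  have [|y0 ay0 Zx0] := cover x0.
    by move: bx0; rewrite lt_min => /and3P[-> ->].
  (* Only finitely many points of []b, e'[] have appeared by [y0], and all others are [lt]-below
     them. Hence the maximum of this finite part of [A] is the maximum of [A]. *)
  have [r hr] := finZ _ ay0.
  pose r' := [seq x <- r | `[< b < x < e' /\ A x /\ Z x y0 >]].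
  have r'E x : x \in r' <-> b < x < e' /\ A x /\ Z x y0.
    rewrite mem_filter; split=> [/andP[/asboolP//]|h].
    by apply/andP; split; [exact/asboolP|case: h => hx [_]; apply: hr].
  have [|m /r'E[hm [Am Zm]] mmax] := @seq_max _ _ lt r' x0 ltT ltt.
    exact/r'E.
  exists m; split=> // x hx Ax xm; have [Zx|nZx] := pselect (Z x y0).
    by apply: mmax => //; apply/r'E.
  by left=> /(_ _ ay0 Zm).
(* The order [lt] is definable from [Z], hence so is the set of left children, and tameness decides
   its germ at [b]. *)
apply: definable_decides_germ; rewrite /left_child /lt /le; defin.
all: by apply: def_bin hZ _ _; coord.
Qed.

(** * Increasing families and finite covers on boxes *)

Definition has_box n (A : ('I_n -> M) -> Prop) := exists l u : 'I_n -> M,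
  (forall i, l i < u i) /\ forall x, (forall i, l i < x i < u i) -> A x.

Lemma has_box_snoc n (A : ('I_n.+1 -> M) -> Prop) p q : p < q ->
  has_box (fun x => forall t, p < t -> t < q -> A (snoc x t)) -> has_box A.
Proof.
move=> pq [l [u [lu hA]]]; exists (snoc l p), (snoc u q); split.
  by move=> i; rewrite /snoc; case: (unlift ord_max i).
move=> x hx; rewrite -(snoc_eta x).
have /andP[px xq] := hx ord_max; rewrite !snoc_max in px xq.
by apply: hA => // i; have := hx (lift ord_max i); rewrite !snoc_lift.
Qed.

Lemma snoc_box n (l u : 'I_n.+1 -> M) (x : 'I_n -> M) t :
  (forall i, l (lift ord_max i) < x i < u (lift ord_max i)) ->
  l ord_max < t < u ord_max -> forall i, l i < snoc x t i < u i.
Proof.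
move=> hx ht i; case: (unliftP ord_max i) => [j ->|->].
  by rewrite snoc_lift.
by rewrite snoc_max.
Qed.

(** Named so that [has_box_germ] can be used inside the induction proving it, where it is known only
    in the lower dimension. *)
Definition union_property n := forall (Z : ('I_n -> M) -> M -> Prop) a l u,
  def2 S Z -> (forall x, antitone_above a (Z x)) -> (forall i, l i < u i) ->
  (forall x, (forall i, l i < x i < u i) -> exists2 y, a < y & Z x y) ->
  exists2 y, a < y & has_box (Z^~ y).

(* The dimension-n union property, with the end point s of the germ as y. *)
Lemma has_box_germ n (A : ('I_n.+1 -> M) -> Prop) c :
  union_property n -> def S A ->
  has_box (fun x => exists s, c < s /\
    forall t, c < t -> t < s -> A (snoc x t)) -> has_box A.
Proof.
move=> unionP dA [l [u [lu hA]]].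
have [||||s cs] := unionP
  (fun x s => forall t, c < t -> t < s -> A (snoc x t)) c l u.
- rewrite /def2; defin.
  by apply: def_comp dA _; apply: coordinate_snoc; coord.
- move=> x s s' cs' s's h t ct ts'; apply: h => //; exact: lt_le_trans s's.
- exact: lu.
- by move=> x /hA[s [cs h]]; exists s.
exact: has_box_snoc.
Qed.

(** The lower dimension is used three times, to make uniform in [x] first a range of last
    coordinates, then [y], then the length of a germ. *)
Lemma union_box n : union_property n.
Proof.
have [dense _ _] := dlo.
elim: n => [|n IH] Z a l u dZ anti lu cover.
  have [|y ay Zy] := cover l; first by case.
  exists y => //; exists l, u; split=> // x _.
  by rewrite (_ : x = l) //; apply/funext; case.
have [q /andP[lq qu]] := dense _ _ (lu ord_max).
pose G x t := exists y, a < y /\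
  exists s, t < s /\ forall z, t < z -> z < s -> Z (snoc x z) y.
have [||||s qs hG] := IH (fun x s => forall t, q < t -> t < s -> G x t) q
  (fun i => l (lift ord_max i)) (fun i => u (lift ord_max i)).
- rewrite /def2 /G; defin.
  by apply: def2_comp dZ _ _; [apply: coordinate_snoc; coord|coord].
- move=> x s s' cs' s's h t ct ts'; apply: h => //; exact: lt_le_trans s's.
- by [].
- move=> x hx; have [[s qs sG]|[s qs sG]] : decides_germ q (G x).
    apply: definable_decides_germ; rewrite /G; defin.
    by apply: def2_comp dZ _ _; [apply: coordinate_snoc; coord|coord].
  + by exists s => // t qt ts; apply: sG; rewrite qt.
  (* If [G x] failed on a right germ at [q], the one-dimensional case there would give an interval
     inside a single member of the family, and [G x] holds at each of its points. *)
  have [||||y ay [v [w [qv vw ws hZ]]]] := @union_interval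
    (fun t y => Z (snoc x t) y) a q (Order.min s (u ord_max)).
  + rewrite /def2; apply: def2_comp dZ _ _; [apply: coordinate_snoc|]; coord.
  + by rewrite lt_min qs.
  + by move=> t; apply: anti.
  + move=> t; rewrite lt_min => /and3P[qt ts tu]; apply: cover.
    by apply: snoc_box => //; rewrite (lt_trans lq qt).
  exfalso; have [t /andP[vt tw]] := dense _ _ vw; apply: (sG t).
    rewrite (le_lt_trans qv vt) (lt_le_trans tw) //.
    by move: ws; rewrite le_min => /andP[].
  exists y; split=> //; exists w; split=> // z tz zw.
  by apply: hZ; rewrite (lt_trans vt tz).
(* [G] was obtained only strictly to the right of [q], so the germs are now taken at a fixed [c] in
   []q, s[]. *)
have [c /andP[qc cs]] := dense _ _ qs.
have [l1 [u1 [lu1 {}hG]]] := hG.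
have [||||y ay hy] := IH (fun x y => exists s, c < s /\
  forall z, c < z -> z < s -> Z (snoc x z) y) a l1 u1.
- rewrite /def2; defin.
  by apply: def2_comp dZ _ _; [apply: coordinate_snoc; coord|coord].
- move=> x y y' ay' y'y [s0 [cs0 h]]; exists s0; split=> // z cz zs0.
  exact: anti (h _ cz zs0).
- by [].
- by move=> x /hG/(_ c qc cs)[y [ay h]]; exists y.
(* [y] no longer depends on [x], but the length of the germ at [c] still does; [has_box_germ]
   removes this dependence. *)
exists y => //; apply: has_box_germ IH _ hy.
by apply: def2_comp dZ _ _; coord.
Qed.

Lemma box_union n (A B : ('I_n -> M) -> Prop) l u :
  def S A -> def S B -> (forall i, l i < u i) ->
  (forall x, (forall i, l i < x i < u i) -> A x \/ B x) ->
  has_box A \/ has_box B.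
Proof.
have [dense _ _] := dlo.
elim: n A B l u => [|n IH] A B l u dA dB lu cover.
  have const (C : ('I_0 -> M) -> Prop) : C l -> has_box C.
    move=> Cl; exists l, u; split=> // x _.
    by rewrite (_ : x = l) //; apply/funext; case.
  by have [|/const|/const] := cover l; [case|left|right].
have [a /andP[la au]] := dense _ _ (lu ord_max).
pose germ (C : ('I_n.+1 -> M) -> Prop) x := exists s, a < s /\
  forall t, a < t -> t < s -> C (snoc x t).
have dgerm C : def S C -> def S (germ C).
  move=> dC; rewrite /germ; defin.
  by apply: def_comp dC _; apply: coordinate_snoc; coord.
have [||hA|hB] := IH (germ A) (germ B) (fun i => l (lift ord_max i))
  (fun i => u (lift ord_max i)) (dgerm _ dA) (dgerm _ dB).
- by [].
- move=> x hx; have [[s qs sA]|[s qs sA]] : decides_germ a (fun t => A (snoc x t)).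
  + apply: definable_decides_germ.
    by apply: def_comp dA _; apply: coordinate_snoc; coord.
  + by left; exists s; split=> // t at_ ts; apply: sA; rewrite at_.
  (* Where the fiber avoids [A], the cover forces [B]; the minimum keeps the points inside the
     box. *)
  right; exists (Order.min s (u ord_max)); rewrite lt_min qs; split=> // t at_.
  rewrite lt_min => /andP[ts tu].
  have [||//] := cover (snoc x t).
    by apply: snoc_box => //; rewrite (lt_trans la at_).
  by move=> At; case: (sA t) => //; rewrite at_.
- by left; apply: has_box_germ (@union_box n) dA hA.
- by right; apply: has_box_germ (@union_box n) dB hB.
Qed.

(** * Boxes and the product topology *)

Lemma has_box_interior n (A : set {ptws 'I_n -> M}) :
  has_box A -> (A°)%classic !=set0.
Proof.
have [dense _ _] := dlo.
move=> [l [u [lu hA]]]; have [x hx] := choice (fun i => dense _ _ (lu i)).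
exists x; apply: (@filterS _ (nbhs (x : {ptws 'I_n -> M})) _
  [set y | forall i, l i < y i < u i]) => //.
apply: (filter_forall (F := nbhs (x : {ptws _ -> _}))) => i.
apply: (@proj_continuous _ (fun=> M) i x [set t | l i < t < u i]).
apply: open_nbhs_nbhs; split; last exact: hx.
rewrite (_ : mkset _ = `]l i, u i[%classic); first exact: itv_open.
by apply/seteqP; split=> t /=; rewrite in_itv.
Qed.

(** The product topology is a supremum of topologies induced by the projections, so it suffices that
    the filter of boxes around [x] converges in each coordinate. Bounded boxes suffice since [M] has
    no endpoints. *)
Lemma nbhs_box n (U : set {ptws 'I_n -> M}) (x : {ptws 'I_n -> M}) :
  nbhs x U -> has_box U.
Proof.
have [_ ltl ltr] := dlo.
pose F : set_system {ptws 'I_n -> M} := filter_from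
  [set lu : ('I_n -> M) * ('I_n -> M) | forall i, lu.1 i < x i < lu.2 i]
  (fun lu => [set y | forall i, lu.1 i < y i < lu.2 i]).
have FF : Filter F.
  apply: filter_from_filter.
    have [l hl] := choice (fun i => ltl (x i)).
    have [u hu] := choice (fun i => ltr (x i)).
    by exists (l, u) => i /=; rewrite hl hu.
  move=> [l u] [l' u'] /= h h'.
  exists (fun i => Order.max (l i) (l' i), fun i => Order.min (u i) (u' i)) => /=.
    move=> i; rewrite gt_max lt_min.
    by case/andP: (h i) => -> ->; case/andP: (h' i) => -> ->.
  move=> y hy; split=> i /=; have := hy i; rewrite gt_max lt_min.
    by case/andP=> /andP[-> _] /andP[].
  by case/andP=> /andP[_ ->] /andP[].
suff Fx : F --> x.
  move=> /Fx[[l u] /= h lU]; exists l, u; split=> // i.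
  by have /andP[] := h i; apply: lt_trans.
apply/cvg_sup => i V.
rewrite nbhsE => -[W [[P oP <-] Px] WV]; apply: filterS WV _.
have [p [q [px xq pqP]]] := nbhs_itv dlo (open_nbhs_nbhs (conj oP Px)).
have [l hl] := choice (fun i => ltl (x i)).
have [u hu] := choice (fun i => ltr (x i)).
(* Only coordinate [i] is constrained; the others get arbitrary bounds around [x]. *)
exists (fun j => if j == i then p else l j, fun j => if j == i then q else u j).
  by move=> j /=; case: eqP => [->|_]; apply/andP.
by move=> y /(_ i) /=; rewrite eqxx => /pqP.
Qed.

End Families.

Theorem theorem3p9 (d : Order.disp_t) (M : orderTopologicalType d)
    (L : language) (S : expansion L M) (n : nat)
    (X X1 X2 : set {ptws 'I_n -> M}) :
  dense_without_endpoints M ->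
  unif_locally_weakly_ominimal2 S ->
  definable S X -> X° !=set0 ->
  definable S X1 -> definable S X2 ->
  X = X1 `|` X2 -> X1 `&` X2 = set0 ->
  X1° !=set0 \/ X2° !=set0.
Proof.
move=> dlo tame _ [x Xx] [p EX1] [q EX2] EX _.
have [l [u [lu hX]]] := nbhs_box dlo Xx.
have [|||/(has_box_interior dlo)|/(has_box_interior dlo)] :=
  @box_union _ _ _ _ dlo tame n X1 X2 l u _ _ lu; [| | |by left|by right].
- by exists p => y; rewrite EX1.
- by exists q => y; rewrite EX2.
- by move=> y /hX; rewrite EX.
Qed.
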